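(* Let $k,N$ be positive integers and define $$J_{k,N}(x):=\int_0^1\left(\frac{2^{k-1}}{u-1}-\frac{2^Nu^{2^N-1}}{u^{2^N}-1}-\frac{2^{k-1}-1}{u\log u}\right){}_N\mathrm{Li}_k(-u^x)\,du.$$ Then for $x>0$, $$J_{k,N}(x)=\mathscr{F}_{k,N}(2^Nx)-\left(2^{k-1}+2^{1-k}\right)\mathscr{F}_{k,N}(x)+\mathscr{F}_{k,N}\left(\frac{x}{2^N}\right)+\left(2^N+2^{-N}-2^{k-1}-2^{1-k}\right)\frac{\zeta(k+N)}{x}.$$
   Context: For $N\in\mathbb{N}$, $s\in\mathbb{C}$ and $|t|<1$, ${}_N\mathrm{Li}_s(t):=\sum_{n=1}^\infty\frac{t^{n^N}}{n^s}$. For positive real $k,N$ with $k+N>1$ and $x\in\mathbb{C}\setminus(-\infty,0]$, $\mathscr{F}_{k,N}(x):=\sum_{n=1}^{\infty}\frac{\psi(n^Nx)-\log(n^Nx)}{n^k}$, with $\psi=\Gamma'/\Gamma$. $\zeta$ is the Riemann zeta function. *)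

(* Defs.v *)
From HB Require Import structures.
From mathcomp Require Import all_boot all_order all_algebra.
From mathcomp Require Import all_classical all_reals all_analysis.

Set Implicit Arguments.
Unset Strict Implicit.
Unset Printing Implicit Defensive.

Import Order.TTheory GRing.Theory Num.Theory.
Import numFieldNormedType.Exports.

Local Open Scope classical_set_scope.
Local Open Scope ring_scope.

(* Infinite sums are limits of real partial sums, and integrals are real-valued
   Lebesgue integrals; all functions below are only meaningful on the stated
   ranges, where the sums and integrals converge. *)

Section Functions.
Context {R : realType}.
Local Notation mu := (@lebesgue_measure R).

(* s > 1 *)
Definition zeta (s : R) : R := \big[+%R/0]_(1 <= n <oo) (n%:R `^ s)^-1.

(* x > 0 *)
Definition Gamma (x : R) : R :=
  \int[mu]_(t in `]0, +oo[) (t `^ (x - 1) * expR (- t)).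

(* x > 0 *)
Definition digamma (x : R) : R := derive1 Gamma x / Gamma x.

(* The generalized polylogarithm _N Li_s(t), for |t| < 1 *)
Definition Li (N : nat) (s t : R) : R :=
  \big[+%R/0]_(1 <= n <oo) (t ^+ (n ^ N) / n%:R `^ s).

(* The higher Herglotz function F_{k,N}(x), for k, N > 0, k + N > 1, x > 0 *)
Definition herglotz (k N x : R) : R :=
  \big[+%R/0]_(1 <= n <oo)
    ((digamma (n%:R `^ N * x) - ln (n%:R `^ N * x)) / n%:R `^ k).

Definition J_integrand (k N : nat) (x u : R) : R :=
  (2 ^ (k%:Z - 1) / (u - 1)
   - 2 ^+ N * u ^+ (2 ^ N - 1) / (u ^+ (2 ^ N) - 1)
   - (2 ^ (k%:Z - 1) - 1) / (u * ln u)) * Li N k%:R (- (u `^ x)).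

Definition J (k N : nat) (x : R) : R :=
  \int[mu]_(u in `]0, 1[) J_integrand k N x u.

End Functions.

(* Main.v *)
Require Import Defs.
From HB Require Import structures.
From mathcomp Require Import all_boot all_order all_algebra.
From mathcomp Require Import all_classical all_reals all_analysis.
From mathcomp Require Import measurable_realfun ring lra.

Set Implicit Arguments.
Unset Strict Implicit.
Unset Printing Implicit Defensive.

Import Order.TTheory GRing.Theory Num.Theory.
Import numFieldNormedType.Exports.

Local Open Scope classical_set_scope.
Local Open Scope ring_scope.

(** Write [M = 2^N] and, for [c >= 1],
    [K_c(u) = c u^(c-1) / (u^c - 1) - 1 / (u log u)] on [(0,1)], so that
    [0 <= K_c(u) <= c / u]. Binet's formula reads
    [int_0^1 K_c(u) u^(c z) du = B(z)] with [B(z) = psi(z) - log z + 1/z]: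
    both sides lie in [[0, 1/z]] and have the same increment
    [1/(z+1) - log((z+1)/z)] under [z -> z+1], so their difference is periodic
    and vanishes at infinity. For the left-hand side the increment is a Frullani
    integral; for the right-hand side the bounds come from integrating
    [log t <= log y + t/y - 1] against the Gamma density.

    The bracket in [J] is [2^(k-1) K_1 - K_M], and separating even and odd
    indices gives [Li(-z) = - Li(z) + 2^(1-k) Li(z^M)]. Hence the integrand is
    a combination of the four nonnegative functions [K_c(u) Li(u^y)],
    [c = 1, M], [y = x, M x], which can be integrated term by term:
    [int K_c Li(u^y) = sum_n B(n^N y / c) / n^k], that is
    [F(y/c) + zeta(k+N) c / y]. *)

(** * Improper integrals of powers *)

Section ImproperIntegrals.
Context {R : realType}.
Local Notation mu := (@lebesgue_measure R).
Implicit Types (f F : R -> R) (a b u y : R).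

Lemma continuous_powR a u : 0 < u -> {for u, continuous (@powR R ^~ a)}.
Proof.
move=> u0; apply/differentiable_continuous/derivable1_diffP.
by apply: derivable_powR; rewrite in_itv/= andbT.
Qed.

(** The integrand may blow up at 0, so []0, b]] is exhausted by compact intervals on which the
    fundamental theorem applies. Nonnegativity gives convergence of the integrals along this
    exhaustion, and [F] tending to 0 at 0 removes the lower boundary term. *)
Lemma ge0_FTC2_oo f F b : 0 < b ->
  (forall u, 0 < u -> {for u, continuous f}) ->
  (forall u, 0 < u -> is_derive u 1 F (f u)) ->
  F u @[u --> 0^'+] --> 0 ->
  (forall u, 0 < u <= b -> 0 <= f u) ->
  (\int[mu]_(u in `]0%R, b[) (f u)%:E = (F b)%:E)%E.
Proof.
move=> b0 cf dF F0 f0.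
have mfy : measurable_fun (`]0, +oo[ : set R) f.
  apply: open_continuous_measurable_fun; first exact: interval_open.
  by move=> u; rewrite inE/= in_itv/= andbT; exact: cf.
have mf : measurable_fun `]0, b] f.
  by apply: measurable_funS mfy => //; apply: subset_itvl; rewrite bnd_simp.
rewrite integral_itv_bndo_bndc; last first.
  apply/measurable_EFinP; apply: measurable_funS mf => //.
  by apply: subset_itvl; rewrite bnd_simp.
(* The divisor [n.+2] keeps the left endpoint strictly below [b], also for [n = 0]. *)
pose S (n : nat) := `[b / n.+2%:R, b]%classic.
have bn (n : nat) : 0 < b / n.+2%:R by rewrite divr_gt0.
have SU : \bigcup_n S n = `]0, b]%classic.
  apply/seteqP; split => [u [n _]|u]/=.
    by rewrite /S/= !in_itv/= => /andP[/(lt_le_trans (bn n)) -> ->].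
  rewrite in_itv/= => /andP[u0 ub]; exists (Num.truncn (b / u)) => //.
  rewrite /S/= in_itv/= ub andbT ler_pdivrMr// mulrC -ler_pdivrMr//.
  rewrite ltW// (lt_trans (truncnS_gt _))//.
  by rewrite ltr_nat.
rewrite -SU.
have FS n : (\int[mu]_(u in S n) (f u)%:E = (F b)%:E - (F (b / n.+2%:R))%:E)%E.
  have ltb : b / n.+2%:R < b by rewrite ltr_pdivrMr// ltr_pMr// ltr1n.
  apply: continuous_FTC2 => //.
  - apply: continuous_in_subspaceT => u; rewrite inE/= in_itv/= => /andP[bu _].
    exact/cf/(lt_le_trans (bn n)).
  - have cF u : 0 < u -> {for u, continuous F}.
      move=> u0; apply/differentiable_continuous/derivable1_diffP.
      by have [] := dF u u0.
    split.
    + move=> u; rewrite in_itv/= => /andP[bu _].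
      by have [] := dF u (lt_trans (bn n) bu).
    + exact/cvg_at_right_filter/cF.
    + exact/cvg_at_left_filter/cF.
  - move=> u; rewrite in_itv/= => /andP[bu _]; rewrite derive1E.
    by have [_ ->] := dF u (lt_trans (bn n) bu).
have cvg1 : (\int[mu]_(u in S n) (f u)%:E @[n --> \oo] -->
             \int[mu]_(u in \bigcup_n S n) (f u)%:E)%E.
  apply: ge0_nondecreasing_set_cvg_integral => //.
  - move=> m n mn; apply/subsetPset; rewrite /S; apply: subset_itvr.
    by rewrite bnd_simp ler_pM2l// lef_pV2 ?posrE// ler_nat.
  - by move=> n; exact: measurable_itv.
  - move=> n; apply/measurable_EFinP; apply: measurable_funS mf => //.
    by apply: subset_itvr; rewrite bnd_simp.
  - move=> n u; rewrite /S/= in_itv/= => /andP[bu ub].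
    by rewrite lee_fin f0// ub (lt_le_trans (bn n)).
have {}FS n : (\int[mu]_(u in S n) (f u)%:E = (F b - F (b / n.+2%:R))%:E)%E.
  by rewrite FS -EFinB.
suff cvg2 : (\int[mu]_(u in S n) (f u)%:E @[n --> \oo] --> (F b)%:E)%E.
  exact: (cvg_unique _ cvg1 cvg2).
rewrite (eq_cvg _ _ FS).
apply: cvg_EFin; first exact: nearW.
rewrite -[X in _ --> X]subr0; apply: cvgB; first exact: cvg_cst.
move/cvg_at_rightP : F0 => /(_ (fun n => b / n.+2%:R)); apply; split => //.
rewrite -[X in _ --> X](mulr0 b); apply: cvgM; first exact: cvg_cst.
by have := @cvg_harmonic R; rewrite -(cvg_shiftn 1); under eq_fun do rewrite addn1.
Qed.

Lemma measurable_fun_powR a (D : set R) : measurable_fun D (@powR R ^~ a).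
Proof. by apply: measurable_funTS; exact: measurable_powR. Qed.

Lemma integral_powR a : 0 < a ->
  (\int[mu]_(u in `]0%R, 1%R[) (u `^ (a - 1))%:E = (a^-1)%:E)%E.
Proof.
move=> a0.
have := @ge0_FTC2_oo (fun u => u `^ (a - 1)) (fun u => a^-1 * u `^ a) 1 ltr01.
rewrite powR1 mulr1; apply.
- by move=> u; exact: continuous_powR.
- move=> u u0; have -> : u `^ (a - 1) = a^-1 *: (a * u `^ (a - 1)).
    by rewrite /GRing.scale/= mulKf// gt_eqF.
  by apply: is_deriveZ; exact: is_derive1_powR.
- by rewrite -[X in _ --> X](mulr0 a^-1); apply: cvgM; [exact: cvg_cst|exact: powR_cvg0].
- by move=> u _; exact: powR_ge0.
Qed.

Lemma integrable_powR a : 0 < a ->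
  mu.-integrable `]0, 1[ (fun u => (u `^ (a - 1))%:E).
Proof.
move=> a0; apply/integrableP; split.
  by apply/measurable_EFinP; exact: measurable_fun_powR.
under eq_integral do rewrite gee0_abs ?lee_fin ?powR_ge0//.
by rewrite integral_powR// ltry.
Qed.

Lemma Rintegral_powR a : 0 < a ->
  \int[mu]_(u in `]0, 1[) (u `^ (a - 1)) = a^-1.
Proof. by move=> a0; rewrite /Rintegral integral_powR. Qed.

End ImproperIntegrals.

(** * A Frullani integral *)

Section Frullani.
Context {R : realType}.
Local Notation mu := (@lebesgue_measure R).
Implicit Types (a b u y : R).

Lemma mem_itv01 u : `]0, 1[%classic u -> [/\ 0 < u, u < 1 & ln u < 0].
Proof. by rewrite /= in_itv/= => /andP[u0 u1]; split => //; rewrite ln_lt0 ?u0. Qed.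

Lemma mulr_powRB a u : 0 < u -> u * u `^ (a - 1) = u `^ a.
Proof.
by move=> u0; rewrite -{1}(powRr1 (ltW u0)) -powRD ?subrKC// (gt_eqF u0) implybT.
Qed.

(** This is the integral of [u ^ (s - 1)] over [s] from [a] to [b], which explains the two bounds
    below: for [u] in []0, 1[] that power decreases in [s]. *)
Definition logdiff a b u : R := (u `^ b - u `^ a) / (u * ln u).

(** With [v = (b - a) * ln u], one has [u ^ b = u ^ a * exp v], and the claim becomes
    [1 + v <= exp v]; the sign flips because [u * ln u < 0]. *)
Lemma logdiff_le a b u : `]0, 1[%classic u -> a <= b ->
  logdiff a b u <= (b - a) * u `^ (a - 1).
Proof.
move=> /mem_itv01[u0 u1 l0] ab; rewrite /logdiff.
rewrite ler_ndivrMr; last by rewrite pmulr_rlt0.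
have -> : (b - a) * u `^ (a - 1) * (u * ln u) =
          u `^ a * ((b - a) * ln u) by rewrite -(mulr_powRB a u0); ring.
have -> : u `^ b = u `^ a * expR ((b - a) * ln u).
  by rewrite /powR gt_eqF// -expRD; congr expR; ring.
rewrite -[X in _ <= _ - X]mulr1 -mulrBr ler_pM2l ?powR_gt0//.
by rewrite lerBrDl expR_ge1Dx.
Qed.

Lemma logdiff_ge a b u : `]0, 1[%classic u -> a <= b ->
  (b - a) * u `^ (b - 1) <= logdiff a b u.
Proof.
move=> /mem_itv01[u0 u1 l0] ab; rewrite /logdiff.
rewrite ler_ndivlMr; last by rewrite pmulr_rlt0.
have -> : (b - a) * u `^ (b - 1) * (u * ln u) =
          u `^ b * ((b - a) * ln u) by rewrite -(mulr_powRB b u0); ring.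
have -> : u `^ a = u `^ b * expR (- ((b - a) * ln u)).
  by rewrite /powR gt_eqF// -expRD; congr expR; ring.
rewrite -{1}[X in X - _]mulr1 -mulrBr ler_pM2l ?powR_gt0//.
by rewrite lerBlDl -lerBlDr expR_ge1Dx.
Qed.

Lemma logdiff_ge0 a b u : `]0, 1[%classic u -> a <= b -> 0 <= logdiff a b u.
Proof.
move=> u01 ab; apply: le_trans (logdiff_ge u01 ab).
by rewrite mulr_ge0 ?subr_ge0 ?powR_ge0.
Qed.

Lemma measurable_logdiff a b : measurable_fun (`]0, 1[ : set R) (logdiff a b).
Proof.
apply: open_continuous_measurable_fun; first exact: interval_open.
move=> u /set_mem /mem_itv01[u0 u1 l0].
rewrite /logdiff; apply: cvgM.
  by apply: cvgB; exact: continuous_powR.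
apply: cvgV; first by rewrite mulf_neq0 ?(gt_eqF u0) ?(lt_eqF l0).
by apply: cvgM; [exact: cvg_id|exact: continuous_ln].
Qed.

Lemma integrable_logdiff a b : 0 < a -> a <= b ->
  mu.-integrable `]0, 1[ (EFin \o logdiff a b).
Proof.
move=> a0 ab.
have iP : mu.-integrable `]0, 1[ (fun u => (b - a)%:E * (u `^ (a - 1))%:E)%E.
  by apply: integrableZl => //; exact: integrable_powR.
apply: le_integrable iP => //.
- by apply/measurable_EFinP; exact: measurable_logdiff.
- move=> u u01; rewrite /= lee_fin !ger0_norm ?logdiff_ge0 ?logdiff_le//.
  by rewrite mulr_ge0 ?subr_ge0 ?powR_ge0.
Qed.

Lemma Rintegral_logdiff_bounds a b : 0 < a -> a <= b ->
  (b - a) / b <= \int[mu]_(u in `]0, 1[) logdiff a b u <= (b - a) / a.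
Proof.
move=> a0 ab; have b0 := lt_le_trans a0 ab.
have iZ c : 0 < c -> mu.-integrable `]0, 1[ (EFin \o (fun u => (b - a) * u `^ (c - 1))).
  by move=> c0; exact: (integrableZl _ (b - a) (integrable_powR c0)).
rewrite -(Rintegral_powR a0) -(Rintegral_powR b0).
rewrite -!RintegralZl//; [|exact: integrable_powR..].
apply/andP; split; apply: le_Rintegral => //.
- exact: iZ.
- exact: integrable_logdiff.
- by move=> u u01; exact: logdiff_ge.
- exact: integrable_logdiff.
- exact: iZ.
- by move=> u u01; exact: logdiff_le.
Qed.

(** Cut [[a, b]] into [n + 1] equal pieces: the increments add up to at most
    [C (b - a)^2 / (n + 1)], which tends to 0. *)
Lemma quadratic_increment_cst (g : R -> R) a b C : a <= b ->
  (forall s t, a <= s -> s <= t -> `|g t - g s| <= C * (t - s) ^+ 2) ->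
  g b = g a.
Proof.
move=> ab gC.
have key n : `|g b - g a| <= C * (b - a) ^+ 2 * harmonic n.
  pose s i := a + (b - a) * (i%:R / n.+1%:R).
  have -> : g b - g a = \sum_(0 <= i < n.+1) (g (s i.+1) - g (s i)).
    rewrite telescope_sumr// /s mul0r mulr0 addr0 divff ?mulr1 ?subrKC//.
  apply: (le_trans (ler_norm_sum _ _ _)).
  have step i : `|g (s i.+1) - g (s i)| <= C * (b - a) ^+ 2 / n.+1%:R ^+ 2.
    apply: (le_trans (gC _ _ _ _)).
    - by rewrite lerDl mulr_ge0 ?subr_ge0 ?divr_ge0.
    - by rewrite lerD2l ler_wpM2l ?subr_ge0// ler_pM2r ?invr_gt0// ler_nat.
    - rewrite (_ : s i.+1 - s i = (b - a) / n.+1%:R).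
        by rewrite expr_div_n mulrA.
      by rewrite /s -natr1; ring.
  apply: (le_trans (ler_sum_nat (fun i _ => step i))).
  rewrite big_const_nat iter_addr_0 subn0 -(mulr_natr (C * _ / _)) -[harmonic n]/(n.+1%:R^-1).
  have : n.+1%:R != 0 :> R by rewrite pnatr_eq0.
  move: (n.+1%:R : R) => m m0.
  by rewrite le_eqVlt; apply/orP; left; apply/eqP; field.
apply/eqP; rewrite -subr_eq0 -normr_eq0 eq_le normr_ge0 andbT.
have cvg0 : C * (b - a) ^+ 2 * harmonic n @[n --> \oo] --> (0 : R).
  rewrite -[X in _ --> X](mulr0 (C * (b - a) ^+ 2)).
  by apply: cvgM; [exact: cvg_cst|exact: cvg_harmonic].
by apply: (cvgr_to_ge cvg0); exact: nearW.
Qed.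

Lemma ln_sub_le a b : 0 < a -> 0 < b -> ln b - ln a <= (b - a) / a.
Proof.
move=> a0 b0; rewrite -ln_div ?posrE//.
rewrite (_ : b / a = 1 + (b - a) / a); last by field; rewrite gt_eqF.
apply: le_ln1Dx; rewrite -subr_gt0.
by rewrite (_ : _ - _ = b / a) ?divr_gt0//; field; rewrite gt_eqF.
Qed.

Lemma ln_sub_bounds a b : 0 < a -> a <= b ->
  (b - a) / b <= ln b - ln a <= (b - a) / a.
Proof.
move=> a0 ab; have b0 := lt_le_trans a0 ab.
rewrite ln_sub_le// andbT -(opprB (ln a)) lerNr (le_trans (ln_sub_le b0 a0))//.
by rewrite -mulNr opprB.
Qed.

(** On [[s, t]] both the integral and [ln t - ln s] lie between [(t - s) / t] and [(t - s) / s].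
    These bounds differ by [(t - s)^2 / (s t)], at most [(t - s)^2 / a^2], so the difference of the
    two sides, as a function of the upper exponent, has quadratic increments and keeps its value 0
    at [a]. *)
Lemma Rintegral_logdiff a b : 0 < a -> a <= b ->
  \int[mu]_(u in `]0, 1[) logdiff a b u = ln b - ln a.
Proof.
move=> a0 ab.
pose g t := \int[mu]_(u in `]0, 1[) logdiff a t u - ln t.
suff : g b = g a.
  rewrite /g [in RHS](_ : \int[mu]_(u in _) _ = 0); last first.
    apply/eqP; rewrite eq_le.
    by have := Rintegral_logdiff_bounds a0 (lexx a); rewrite subrr !mul0r andbC.
  lra.
apply: (@quadratic_increment_cst _ _ _ (a ^- 2)) => // s t as_ st.
have s0 := lt_le_trans a0 as_; have t0 := lt_le_trans s0 st.
have -> : g t - g s =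
    \int[mu]_(u in `]0, 1[) logdiff s t u - (ln t - ln s).
  rewrite /g (_ : \int[mu]_(u in `]0, 1[) logdiff a t u =
    \int[mu]_(u in `]0, 1[) (logdiff a s u + logdiff s t u)); last first.
    by apply: eq_Rintegral => u _; rewrite /logdiff; ring.
  rewrite RintegralD//; [ring| |]; exact: integrable_logdiff.
have /andP[D1 D2] := Rintegral_logdiff_bounds s0 st.
have /andP[l1 l2] := ln_sub_bounds s0 st.
have : (t - s) / s - (t - s) / t <= a ^- 2 * (t - s) ^+ 2.
  have -> : (t - s) / s - (t - s) / t = (s * t)^-1 * (t - s) ^+ 2.
    by field; rewrite !gt_eqF.
  apply: ler_wpM2r; first exact: sqr_ge0.
  rewrite lef_pV2 ?posrE ?mulr_gt0 ?exprn_gt0// expr2.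
  by apply: ler_pM => //; [exact: ltW|exact: ltW|exact: le_trans st].
rewrite ler_norml => h; apply/andP; split; lra.
Qed.

End Frullani.

(** * The Binet kernel *)

Section BinetKernel.
Context {R : realType}.
Local Notation mu := (@lebesgue_measure R).
Implicit Types (a b u y : R) (c : nat).

Definition binet_kernel c u : R :=
  c%:R * u ^+ (c - 1) / (u ^+ c - 1) - (u * ln u)^-1.

(** Substituting [u ^ c = w = exp (- L)] reduces both kernel bounds to
    [0 <= 1 / L - w / (1 - w) <= 1]. *)
Lemma binet_kernelE c u : (0 < c)%N -> `]0, 1[%classic u ->
  let L := - (c%:R * ln u) in let w := expR (- L) in
  [/\ 0 < L, 0 < w < 1 &
      binet_kernel c u = c%:R / u * (L^-1 - w / (1 - w))].
Proof.
move=> c0 /mem_itv01[u0 u1 l0] L w.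
have c0' : 0 < c%:R :> R by rewrite ltr0n.
have L0 : 0 < L by rewrite oppr_gt0 pmulr_rlt0.
have w0 : 0 < w by exact: expR_gt0.
have w1 : w < 1 by rewrite expR_lt1 oppr_lt0.
split; [by []|by rewrite w0|].
have uw : u ^+ c = w by rewrite -(powR_mulrn _ (ltW u0)) /powR gt_eqF// /w /L opprK.
have uw' : u ^+ (c - 1) = w / u.
  by rewrite -uw -{2}(subnK c0) addn1 exprSr mulfK// gt_eqF.
rewrite /binet_kernel uw uw' /L; field.
rewrite (lt_eqF l0) (gt_eqF u0) (gt_eqF c0')/=.
by rewrite subr_eq0 eq_sym (lt_eqF w1) subr_eq0 (lt_eqF w1).
Qed.

(** Since [w / (1 - w) = 1 / (exp L - 1)], this is [1 + L <= exp L]. *)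
Lemma binet_kernel_ge0 c u : (0 < c)%N -> `]0, 1[%classic u ->
  0 <= binet_kernel c u.
Proof.
move=> c0 u01; have [L0 /andP[w0 w1] ->] := binet_kernelE c0 u01.
have [u0 _ _] := mem_itv01 u01.
set L := - _ in L0 w0 w1 *; set w := expR _ in w0 w1 *.
rewrite mulr_ge0 ?divr_ge0 ?(ltW u0)// subr_ge0.
rewrite ler_pdivrMr ?subr_gt0// ler_pdivlMl//.
have wV : w * expR L = 1 by rewrite /w expRN mulVf// gt_eqF ?expR_gt0.
have : w * (1 + L) <= w * expR L by rewrite ler_pM2l// expR_ge1Dx.
by rewrite wV; lra.
Qed.

(** Since [1 + w / (1 - w) = 1 / (1 - w)], this is [1 - w <= L], that is [1 - L <= exp (- L)]. *)
Lemma binet_kernel_le c u : (0 < c)%N -> `]0, 1[%classic u ->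
  binet_kernel c u <= c%:R / u.
Proof.
move=> c0 u01; have [L0 /andP[w0 w1] ->] := binet_kernelE c0 u01.
have [u0 _ _] := mem_itv01 u01.
set L := - _ in L0 w0 w1 *.
have w1' : expR (- L) - 1 != 0 by rewrite subr_eq0 lt_eqF.
have Lw : 1 - L <= expR (- L) by exact: expR_ge1Dx.
move: (expR _) w0 w1 w1' Lw => w w0 w1 w1' Lw.
rewrite -[leRHS]mulr1 ler_wpM2l ?divr_ge0 ?(ltW u0)// lerBlDr.
have -> : 1 + w / (1 - w) = (1 - w)^-1.
  by field; rewrite -opprB oppr_eq0.
rewrite lef_pV2 ?posrE ?subr_gt0//; lra.
Qed.

Lemma measurable_binet_kernel c : (0 < c)%N ->
  measurable_fun (`]0, 1[ : set R) (binet_kernel c).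
Proof.
move=> c0; apply: open_continuous_measurable_fun; first exact: interval_open.
move=> u /set_mem /mem_itv01[u0 u1 l0]; rewrite /binet_kernel.
apply: cvgB.
  apply: cvgM; first by apply: cvgM; [exact: cvg_cst|exact: exprn_continuous].
  apply: cvgV.
    by rewrite subr_eq0 lt_eqF// exprn_ilt1 ?(ltW u0)// -lt0n.
  by apply: cvgB; [exact: exprn_continuous|exact: cvg_cst].
apply: cvgV; first by rewrite mulf_neq0 ?(gt_eqF u0) ?(lt_eqF l0).
by apply: cvgM; [exact: cvg_id|exact: continuous_ln].
Qed.

Lemma measurable_binet_kernelM c y : (0 < c)%N ->
  measurable_fun (`]0, 1[ : set R) (fun u => binet_kernel c u * u `^ y).
Proof.
move=> c0; apply: measurable_funM; first exact: measurable_binet_kernel.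
exact: measurable_fun_powR.
Qed.

Lemma binet_kernelM_le c y u : (0 < c)%N -> `]0, 1[%classic u ->
  binet_kernel c u * u `^ y <= c%:R * u `^ (y - 1).
Proof.
move=> c0 u01; have [u0 _ _] := mem_itv01 u01.
apply: le_trans (_ : c%:R / u * u `^ y <= _).
  by rewrite ler_wpM2r ?powR_ge0 ?binet_kernel_le.
by rewrite -(mulr_powRB y u0) mulrA mulfVK// gt_eqF.
Qed.

Lemma integrable_binet_kernelM c y : (0 < c)%N -> 0 < y ->
  mu.-integrable `]0, 1[ (EFin \o (fun u => binet_kernel c u * u `^ y)).
Proof.
move=> c0 y0.
have iP : mu.-integrable `]0, 1[ (fun u => c%:R%:E * (u `^ (y - 1))%:E)%E.
  by apply: integrableZl => //; exact: integrable_powR.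
apply: le_integrable iP => //.
- by apply/measurable_EFinP; exact: measurable_binet_kernelM.
- move=> u u01; rewrite /= lee_fin !ger0_norm ?binet_kernelM_le//.
    by rewrite mulr_ge0 ?powR_ge0.
  by rewrite mulr_ge0 ?powR_ge0 ?binet_kernel_ge0.
Qed.

Definition binet_int c y : R :=
  \int[mu]_(u in `]0, 1[) (binet_kernel c u * u `^ y).

Lemma binet_int_ge0 c y : (0 < c)%N -> 0 <= binet_int c y.
Proof.
move=> c0; apply: Rintegral_ge0 => u u01.
by rewrite mulr_ge0 ?powR_ge0 ?binet_kernel_ge0.
Qed.

Lemma binet_int_le c y : (0 < c)%N -> 0 < y -> binet_int c y <= c%:R / y.
Proof.
move=> c0 y0; rewrite -(Rintegral_powR y0) -RintegralZl//; last exact: integrable_powR.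
apply: le_Rintegral => //.
- exact: integrable_binet_kernelM.
- exact: (integrableZl _ c%:R (integrable_powR y0)).
- by move=> u; exact: binet_kernelM_le.
Qed.

(** The shift multiplies the integrand by [u ^ c], and the factor [u ^ c - 1] in the difference
    clears the first denominator of the kernel. There remain a pure power and the Frullani integrand
    [logdiff y (y + c)]. *)
Lemma binet_int_step c y : (0 < c)%N -> 0 < y ->
  binet_int c (y + c%:R) - binet_int c y =
  c%:R / (y + c%:R) - (ln (y + c%:R) - ln y).
Proof.
move=> c0 y0; have c0' : 0 < c%:R :> R by rewrite ltr0n.
have yc0 : 0 < y + c%:R by exact: addr_gt0.
have lyc : y <= y + c%:R by rewrite lerDl ltW.
rewrite -RintegralB//; [|exact: integrable_binet_kernelM..].
rewrite -(Rintegral_logdiff y0 lyc) -(Rintegral_powR yc0).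
rewrite -RintegralZl//; last exact: integrable_powR.
rewrite -RintegralB//; last 2 first.
- exact: (integrableZl _ c%:R (integrable_powR yc0)).
- exact: integrable_logdiff.
apply: eq_Rintegral => u /set_mem u01; have [u0 u1 l0] := mem_itv01 u01.
have -> : u `^ (y + c%:R) = u `^ y * u ^+ c.
  by rewrite powRD ?(gt_eqF u0) ?implybT// powR_mulrn// ltW.
have -> : u `^ (y + c%:R - 1) = u `^ y * u ^+ (c - 1).
  by rewrite -addrA -[1]/(1%:R) -natrB// powRD ?(gt_eqF u0) ?implybT// powR_mulrn// ltW.
have -> : logdiff y (y + c%:R) u = u `^ y * (u ^+ c - 1) / (u * ln u).
  rewrite /logdiff powRD ?(gt_eqF u0) ?implybT// powR_mulrn ?(ltW u0)//.
  by rewrite mulrBr mulr1.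
have uc : u ^+ c - 1 != 0.
  by rewrite subr_eq0 lt_eqF// exprn_ilt1 ?(ltW u0)// -lt0n.
rewrite /binet_kernel -mulrBr.
by field; rewrite uc (gt_eqF u0) (lt_eqF l0).
Qed.

End BinetKernel.

(** * The Gamma function *)

Section GammaFunction.
Context {R : realType}.
Local Notation mu := (@lebesgue_measure R).
Implicit Types (a b t y : R).

Definition gammaf y t : R := t `^ (y - 1) * expR (- t).

Lemma gammaf_ge0 y t : 0 <= gammaf y t.
Proof. by rewrite mulr_ge0 ?powR_ge0 ?expR_ge0. Qed.

Lemma gammafS y t : 0 < t -> gammaf (y + 1) t = t * gammaf y t.
Proof. by move=> t0; rewrite /gammaf addrK mulrA mulr_powRB. Qed.

Lemma measurable_gammaf y (D : set R) : measurable_fun D (gammaf y).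
Proof.
apply: measurable_funTS; apply: measurable_funM; first exact: measurable_fun_powR.
by apply: measurableT_comp; [exact: measurable_expR|exact: measurable_funN].
Qed.

Lemma continuous_gammaf y t : 0 < t -> {for t, continuous (gammaf y)}.
Proof.
move=> t0; rewrite /gammaf; apply: cvgM; first exact: continuous_powR.
apply: continuous_comp; first exact: opp_continuous.
exact: continuous_expR.
Qed.

(** Half of the exponential decay absorbs the power: [y * ln (t / (2 * y)) <= t / 2]. *)
Lemma powR_expR_le y t : 0 < y -> 0 < t ->
  t `^ y * expR (- t) <= expR (y * ln (2 * y)) * expR (- (2^-1 * t)).
Proof.
move=> y0 t0; rewrite /powR (gt_eqF t0) -!expRD ler_expR.
have y2 : 0 < 2 * y by rewrite mulr_gt0.
have : y * ln t <= y * ln (2 * y) + 2^-1 * t.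
  have /ln_sublinear/ltW := divr_gt0 t0 y2.
  rewrite ln_div ?posrE// -(ler_pM2l y0).
  have -> : y * (t / (2 * y)) = 2^-1 * t by field; rewrite gt_eqF.
  by rewrite mulrBr; lra.
lra.
Qed.

(** The dominating function is the sum of [t ^ (y - 1)] cut off to []0, 1[] and a multiple of the
    exponential density of rate 1/2, which takes care of [t >= 1]. *)
Lemma integrable_gammaf y : 0 < y ->
  mu.-integrable `]0, +oo[ (EFin \o gammaf y).
Proof.
move=> y0.
(* The factor 2 cancels the rate in front of the exponential density. *)
pose C := 2 * expR (y * ln (2 * y)).
have C0 : 0 <= C by rewrite mulr_ge0 ?expR_ge0.
pose p := @exponential_pdf R 2^-1.
pose g1 : R -> \bar R := (fun u => (u `^ (y - 1))%:E) \_ `]0, 1[.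
pose g2 u := (C%:E * (p u)%:E)%E.
have i1 : mu.-integrable setT g1.
  by rewrite -integrable_mkcond//; exact: integrable_powR.
have i2 : mu.-integrable setT g2.
  by apply: integrableZl => //; exact: integrable_exponential_pdf.
have i4 : mu.-integrable `]0, +oo[ (g1 \+ g2)%E.
  by apply: integrableS (integrableD measurableT i1 i2).
apply: le_integrable i4 => //.
  by apply/measurable_EFinP; exact: measurable_gammaf.
move=> t /=; rewrite in_itv/= andbT => t0.
have p0 : 0 <= p t by exact: exponential_pdf_ge0.
rewrite /g1 patchE; case: ifPn => [|].
  rewrite inE/= in_itv/= => /andP[_ t1].
  rewrite lee_fin !ger0_norm ?gammaf_ge0 ?addr_ge0 ?mulr_ge0 ?powR_ge0//.
  apply: (@le_trans _ _ (t `^ (y - 1))); last by rewrite lerDl mulr_ge0.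
  by rewrite /gammaf ler_piMr ?powR_ge0// expR_le1 oppr_le0 ltW.
rewrite notin_setE/= in_itv/= t0/= => /negP; rewrite -leNgt => t1.
rewrite add0r lee_fin !ger0_norm ?gammaf_ge0 ?mulr_ge0//.
rewrite /p exponential_pdfE ?(ltW t0)//= /C mulNr.
apply: (@le_trans _ _ (t `^ y * expR (- t))).
  by rewrite ler_wpM2r ?expR_ge0// ler_powR// lerBlDr lerDl.
apply: (le_trans (powR_expR_le y0 t0)).
by rewrite le_eqVlt; apply/orP; left; apply/eqP; field.
Qed.

(** On []0, 1[] one has [exp (- t) >= exp (- 1)], whence [Gamma y >= exp (- 1) / y]. *)
Lemma Gamma_gt0 y : 0 < y -> 0 < Gamma y.
Proof.
move=> y0.
have iG := integrable_gammaf y0.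
have i01 : mu.-integrable `]0, 1[ (EFin \o gammaf y).
  apply: integrableS iG => //; by apply: subset_itvl; rewrite bnd_simp.
have : \int[mu]_(t in `]0, 1[) gammaf y t <= Gamma y.
  apply: fine_le; [exact: integrable_fin_num|exact: integrable_fin_num|].
  apply: ge0_subset_integral => //.
  - by apply/measurable_EFinP; exact: measurable_gammaf.
  - by move=> t _; rewrite lee_fin gammaf_ge0.
  - by apply: subset_itvl; rewrite bnd_simp.
apply: lt_le_trans.
have : \int[mu]_(t in `]0, 1[) (expR (-1) * t `^ (y - 1)) <=
    \int[mu]_(t in `]0, 1[) gammaf y t.
  apply: le_Rintegral => //.
    exact: (integrableZl _ (expR (-1)) (integrable_powR y0)).
  move=> t /mem_itv01[t0 t1 _]; rewrite mulrC ler_wpM2l ?powR_ge0//.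
  by rewrite ler_expR lerN2 ltW.
apply: lt_le_trans; rewrite RintegralZl//; last exact: integrable_powR.
by rewrite Rintegral_powR// mulr_gt0 ?expR_gt0 ?invr_gt0.
Qed.

Lemma is_derive_expRN t : is_derive t 1 (fun t => expR (- t)) (- expR (- t)).
Proof.
have -> : - expR (- t) = expR (- t) * -1 by rewrite mulrN1.
by apply: is_derive1_comp.
Qed.

Lemma is_derive_powR_expR y t : 0 < t ->
  is_derive t 1 (fun t => t `^ y * expR (- t)) (y * gammaf y t - gammaf (y + 1) t).
Proof.
move=> t0.
have -> : y * gammaf y t - gammaf (y + 1) t =
  t `^ y *: (- expR (- t)) + expR (- t) *: (y * t `^ (y - 1)).
  by rewrite /gammaf addrK /GRing.scale/=; ring.
by apply: is_deriveM; [exact: is_derive1_powR|exact: is_derive_expRN].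
Qed.

Lemma cvgy_powR_expR y : 0 < y -> t `^ y * expR (- t) @[t --> +oo] --> (0 : R).
Proof.
move=> y0.
apply: (@squeeze_cvgr _ _ _ _ (cst 0) (fun t => expR (y * ln (2 * y)) * expR (- (2^-1 * t)))).
- near=> t; rewrite mulr_ge0 ?powR_ge0 ?expR_ge0//= powR_expR_le//.
- exact: cvg_cst.
- rewrite -[X in _ --> X](mulr0 (expR (y * ln (2 * y)))).
  apply: cvgM; first exact: cvg_cst.
  apply: (cvg_comp (fun t : R => 2^-1 * t) (fun t => expR (- t))); last exact: cvgr_expR.
  by apply: gt0_cvgMry => //; exact: cvg_id.
Unshelve. all: by end_near. Qed.

(** The function [F t = t ^ y * exp (- t)] vanishes at both ends, and its derivative [f] equals
    [(y - t) * gammaf y t]. This changes sign at [t = y], so the integral is split there: the two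
    pieces, of constant sign, contribute [F y] and [- F y]. *)
Lemma GammaS y : 0 < y -> Gamma (y + 1) = y * Gamma y.
Proof.
move=> y0; have y1 : 0 < y + 1 by exact: addr_gt0.
pose f t := y * gammaf y t - gammaf (y + 1) t.
pose F t : R := t `^ y * expR (- t).
have iyf : mu.-integrable `]0, +oo[ (EFin \o (fun t => y * gammaf y t)).
  exact: (integrableZl _ y (integrable_gammaf y0)).
have i1 := integrable_gammaf y1.
have fE t : 0 < t -> f t = (y - t) * gammaf y t.
  by move=> t0; rewrite /f gammafS// mulrBl.
have cf t : 0 < t -> {for t, continuous f}.
  move=> t0; rewrite /f; apply: cvgB; last exact: continuous_gammaf.
  by apply: cvgM; [exact: cvg_cst|exact: continuous_gammaf].
have If : mu.-integrable `]0, +oo[ (EFin \o f) by exact: (integrableB _ iyf i1).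
have dF t : 0 < t -> is_derive t 1 F (f t) by exact: is_derive_powR_expR.
have cF t : 0 < t -> {for t, continuous F}.
  move=> t0; apply/differentiable_continuous/derivable1_diffP.
  by have [] := dF t t0.
suff : \int[mu]_(t in `]0, +oo[) f t = 0.
  rewrite RintegralB// RintegralZl//; last exact: integrable_gammaf.
  by move/eqP; rewrite subr_eq0 => /eqP ->.
have yb : (BLeft y <= +oo)%O by [].
have U : `]0, +oo[%classic = `]0, y[%classic `|` `[y, +oo[%classic :> set R.
  by rewrite -itv_bndbnd_setU// bnd_simp ltW.
rewrite U Rintegral_setU//; last 2 first.
- by rewrite -U.
- apply/disj_setPS => t [/=]; rewrite !in_itv/= => /andP[_ ty].
  by rewrite andbT leNgt ty.
have -> : \int[mu]_(t in `]0, y[) f t = F y.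
  rewrite /Rintegral (ge0_FTC2_oo y0 cf dF)//.
    rewrite -[X in _ --> X](mul0r (expR (- 0))).
    apply: cvgM; first exact: powR_cvg0.
    apply: cvg_at_right_filter; apply: continuous_comp; first exact: opp_continuous.
    exact: continuous_expR.
  by move=> t /andP[t0 ty]; rewrite fE// mulr_ge0 ?gammaf_ge0 ?subr_ge0.
have -> : \int[mu]_(t in `[y, +oo[) f t = 0 - F y.
  rewrite /Rintegral (@le0_continuous_FTC2y _ f F y 0)//.
  - move=> t yt; have t0 := lt_le_trans y0 yt.
    by rewrite fE// mulr_le0_ge0 ?gammaf_ge0 ?subr_le0.
  - apply: continuous_in_subspaceT => t; rewrite inE/= in_itv/= andbT => yt.
    exact/cf/(lt_le_trans y0).
  - exact: cvgy_powR_expR.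
  - exact/cvg_at_right_filter/cF.
  - by move=> t yt; have [] := dF t (lt_trans y0 yt).
  - move=> t; rewrite in_itv/= andbT => yt; rewrite derive1E.
    by have [_ ->] := dF t (lt_trans y0 yt).
by rewrite sub0r subrr.
Qed.

End GammaFunction.

(** * The digamma function *)

Section Digamma.
Context {R : realType}.
Local Notation mu := (@lebesgue_measure R).
Implicit Types (a b t x y : R).

(** Apply [c * ln t = ln (t ^ c) <= t ^ c] with [c = d] and [c = - d]. *)
Lemma norm_ln_le d t : 0 < d -> 0 < t ->
  `|ln t| <= d^-1 * (t `^ d + t `^ (- d)).
Proof.
move=> d0 t0.
have h c : c * ln t <= t `^ c by rewrite -ln_powR ltW// ln_sublinear// powR_gt0.
have := h (- d); have := h d; rewrite -!(ler_pdivlMl _ _ d0) mulNr lerNl => h1.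
rewrite -ler_pdivrMl// mulrN => h2.
have i0 c : 0 <= d^-1 * t `^ c by rewrite mulr_ge0 ?powR_ge0// invr_ge0 ltW.
have := i0 d; have := i0 (- d).
by rewrite ler_norml mulrDr => *; apply/andP; split; lra.
Qed.

Lemma powR_le_ends a b x t : 0 < t -> a <= x <= b ->
  t `^ x <= t `^ a + t `^ b.
Proof.
move=> t0 /andP[ax xb]; have [t1|/ltW t1] := leP t 1.
  by apply: (@le_trans _ _ (t `^ a)); [rewrite ger_powR// t0|rewrite lerDl powR_ge0].
by apply: (@le_trans _ _ (t `^ b)); [rewrite ler_powR|rewrite lerDr powR_ge0].
Qed.

(* Dominates the partial derivatives [ln t * gammaf x t] for [y/2 < x < y+1]. *)
Definition gamma_dom y t : R :=
  (y / 4)^-1 * (gammaf (y / 2 + y / 4) t + gammaf (y + 1 + y / 4) t +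
                gammaf (y / 2 - y / 4) t + gammaf (y + 1 - y / 4) t).

Lemma gamma_dom_ge0 y t : 0 < y -> 0 <= gamma_dom y t.
Proof.
move=> y0; apply: mulr_ge0; first by rewrite invr_ge0 ltW// divr_gt0.
by rewrite !addr_ge0 ?gammaf_ge0.
Qed.

Lemma integrable_gamma_dom y : 0 < y ->
  mu.-integrable `]0, +oo[ (EFin \o gamma_dom y).
Proof.
move=> y0.
have i z : 0 < z -> mu.-integrable `]0, +oo[ (EFin \o gammaf z).
  exact: integrable_gammaf.
have i1 := i (y / 2 + y / 4) ltac:(lra).
have i2 := i (y + 1 + y / 4) ltac:(lra).
have i3 := i (y / 2 - y / 4) ltac:(lra).
have i4 := i (y + 1 - y / 4) ltac:(lra).
have iD (f g : R -> R) : mu.-integrable `]0, +oo[ (EFin \o f) ->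
    mu.-integrable `]0, +oo[ (EFin \o g) ->
    mu.-integrable `]0, +oo[ (EFin \o (f \+ g)).
  by move=> hf hg; exact: (integrableD _ hf hg).
exact: (integrableZl _ (y / 4)^-1 (iD _ _ (iD _ _ (iD _ _ i1 i2) i3) i4)).
Qed.

(** Bound [ln t] by powers of exponent [y / 4] and [- y / 4], and [t ^ (x - 1)] by its values at the
    ends of the range of [x]. The four products are the terms of [gamma_dom]; as [y / 4 < y / 2],
    all their Gamma parameters stay positive. *)
Lemma gamma_domP y x t : 0 < y -> y / 2 < x < y + 1 -> 0 < t ->
  `|ln t * gammaf x t| <= gamma_dom y t.
Proof.
move=> y0 /andP[x1 x2] t0; have d0 : 0 < y / 4 by rewrite divr_gt0.
rewrite normrM [X in _ * X]ger0_norm ?gammaf_ge0//.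
apply: (@le_trans _ _ ((y / 4)^-1 * (t `^ (y / 4) + t `^ (- (y / 4))) *
   ((t `^ (y / 2 - 1) + t `^ (y + 1 - 1)) * expR (- t)))).
  apply: ler_pM => //; [exact: gammaf_ge0|exact: norm_ln_le|].
  by rewrite /gammaf ler_wpM2r ?expR_ge0// powR_le_ends// !lerD2r !ltW.
rewrite /gamma_dom /gammaf.
have tD r s : t `^ (r + s) = t `^ r * t `^ s.
  by rewrite powRD// (gt_eqF t0) implybT.
have -> : y / 2 + y / 4 - 1 = y / 4 + (y / 2 - 1) by ring.
have -> : y + 1 + y / 4 - 1 = y / 4 + (y + 1 - 1) by ring.
have -> : y / 2 - y / 4 - 1 = - (y / 4) + (y / 2 - 1) by ring.
have -> : y + 1 - y / 4 - 1 = - (y / 4) + (y + 1 - 1) by ring.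
rewrite [t `^ (y / 4 + (y / 2 - 1))]tD [t `^ (y / 4 + (y + 1 - 1))]tD.
rewrite [t `^ (- (y / 4) + (y / 2 - 1))]tD [t `^ (- (y / 4) + (y + 1 - 1))]tD.
by rewrite le_eqVlt; apply/orP; left; apply/eqP; ring.
Qed.

Lemma is_derive_gammaf t x : 0 < t ->
  is_derive x 1 (gammaf ^~ t) (ln t * gammaf x t).
Proof.
move=> t0.
have -> : gammaf ^~ t = (fun x => expR (- t) *: expR ((x - 1) * ln t)).
  by apply/funext => z; rewrite /gammaf /powR gt_eqF// mulrC.
have -> : ln t * gammaf x t = expR (- t) *: (expR ((x - 1) * ln t) * ln t).
  by rewrite /gammaf /powR gt_eqF// /GRing.scale/=; ring.
apply: is_deriveZ.
apply: (@is_derive1_comp _ expR (fun x => (x - 1) * ln t)).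
have -> : (fun x => (x - 1) * ln t) = (fun x => ln t *: (x - 1)).
  by apply/funext => z; rewrite mulrC.
have {2}-> : ln t = ln t *: (1 - 0) by rewrite subr0 /GRing.scale/= mulr1.
apply: is_deriveZ.
Qed.

Lemma Gamma_derivableE y : 0 < y ->
  derivable (@Gamma R) y 1 /\
  derive1 (@Gamma R) y = \int[mu]_(t in `]0, +oo[) (ln t * gammaf y t).
Proof.
move=> y0.
have Iy : `](y / 2), (y + 1)[%classic y by rewrite /= in_itv/=; apply/andP; split; lra.
have pos x : `](y / 2), (y + 1)[%classic x -> 0 < x.
  by rewrite /= in_itv/= => /andP[+ _]; apply: lt_trans; rewrite divr_gt0.
have d1 x t : 0 < t -> partial1of2 gammaf x t = ln t * gammaf x t.
  by move=> t0; rewrite partial1of2E; have [_ ->] := is_derive_gammaf x t0.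
have H1 x : `](y / 2), (y + 1)[%classic x -> mu.-integrable `]0, +oo[ (EFin \o gammaf x).
  by move=> /pos; exact: integrable_gammaf.
have H2 x t : `](y / 2), (y + 1)[%classic x -> `]0, +oo[%classic t ->
    derivable (gammaf ^~ t) x 1.
  by move=> _; rewrite /= in_itv/= andbT => /(is_derive_gammaf x)[].
have H3 x t : `](y / 2), (y + 1)[%classic x -> `]0, +oo[%classic t ->
    `|partial1of2 gammaf x t| <= gamma_dom y t.
  rewrite /= !in_itv/= andbT => x1 t0; rewrite d1//; exact: gamma_domP.
rewrite -[@Gamma R]/(fun x => \int[mu]_(t in `]0, +oo[) gammaf x t); split.
  by apply: (derivable_under_integral _ Iy H1 H2 _ (integrable_gamma_dom y0) H3)
    => // t; exact: gamma_dom_ge0.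
rewrite (differentiation_under_integral _ Iy H1 H2 _ (integrable_gamma_dom y0) H3)
  //; last by move=> t; exact: gamma_dom_ge0.
by apply: eq_Rintegral => t; rewrite inE/= in_itv/= andbT => t0; rewrite d1.
Qed.

Lemma integrable_ln_gammaf y : 0 < y ->
  mu.-integrable `]0, +oo[ (EFin \o (fun t => ln t * gammaf y t)).
Proof.
move=> y0; apply: le_integrable (integrable_gamma_dom y0) => //.
  apply/measurable_EFinP; apply: measurable_funM; last exact: measurable_gammaf.
  by apply: measurable_funTS; exact: measurable_ln.
move=> t /=; rewrite in_itv/= andbT => t0; rewrite lee_fin.
rewrite [leRHS]ger0_norm ?gamma_dom_ge0// gamma_domP//; apply/andP; split; lra.
Qed.

(** Jensen's inequality for the Gamma density: the tangent bound [ln t <= ln y + t / y - 1] is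
    integrated against [gammaf y], and its correction [t / y - 1] integrates to 0 because the mean
    of [t] is [Gamma (y + 1) / Gamma y = y]. *)
Lemma digamma_le y : 0 < y -> digamma y <= ln y.
Proof.
move=> y0; have y1 : 0 < y + 1 by exact: addr_gt0.
rewrite /digamma ler_pdivrMr ?Gamma_gt0// (Gamma_derivableE y0).2.
have -> : ln y * Gamma y = (ln y - 1) * Gamma y + y^-1 * Gamma (y + 1).
  by rewrite GammaS//; field; rewrite gt_eqF.
have i1 : mu.-integrable `]0, +oo[ (EFin \o (fun t => (ln y - 1) * gammaf y t)).
  exact: (integrableZl _ (ln y - 1) (integrable_gammaf y0)).
have i2 : mu.-integrable `]0, +oo[ (EFin \o (fun t => y^-1 * gammaf (y + 1) t)).
  exact: (integrableZl _ y^-1 (integrable_gammaf y1)).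
rewrite /Gamma -!RintegralZl//; [|exact: integrable_gammaf..].
rewrite -RintegralD//.
apply: le_Rintegral => //; [exact: integrable_ln_gammaf|exact: (integrableD _ i1 i2)|].
move=> t /=; rewrite in_itv/= andbT => t0; rewrite -!/(gammaf _ _).
rewrite gammafS// mulrA -mulrDl ler_wpM2r ?gammaf_ge0//.
have := ln_sub_le y0 t0.
have -> : (t - y) / y = y^-1 * t - 1 by field; rewrite gt_eqF.
lra.
Qed.

(** Here the tangent is taken at [t]: [t * ln t >= t * ln y + t - y]. Integration against [gammaf y]
    turns the weight [t] into [gammaf (y + 1)], and [t - y] integrates to 0. *)
Lemma digammaS_ge y : 0 < y -> ln y <= digamma (y + 1).
Proof.
move=> y0; have y1 : 0 < y + 1 by exact: addr_gt0.
rewrite /digamma ler_pdivlMr ?Gamma_gt0// (Gamma_derivableE y1).2.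
have -> : ln y * Gamma (y + 1) = (ln y + 1) * Gamma (y + 1) - y * Gamma y.
  by rewrite GammaS//; ring.
have i1 : mu.-integrable `]0, +oo[ (EFin \o (fun t => (ln y + 1) * gammaf (y + 1) t)).
  exact: (integrableZl _ (ln y + 1) (integrable_gammaf y1)).
have i2 : mu.-integrable `]0, +oo[ (EFin \o (fun t => y * gammaf y t)).
  exact: (integrableZl _ y (integrable_gammaf y0)).
rewrite /Gamma -!RintegralZl//; [|exact: integrable_gammaf..].
rewrite -RintegralB//.
apply: le_Rintegral => //; [exact: (integrableB _ i1 i2)|exact: integrable_ln_gammaf|].
move=> t /=; rewrite in_itv/= andbT => t0; rewrite -!/(gammaf _ _).
rewrite gammafS// mulrA -mulrBl [leRHS]mulrA ler_wpM2r ?gammaf_ge0//.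
have : t * (ln y - ln t) <= t * ((y - t) / t) by rewrite ler_pM2l// ln_sub_le.
have -> : t * ((y - t) / t) = y - t by field; rewrite gt_eqF.
lra.
Qed.

Lemma is_derive_shift (g : R -> R) a y : derivable g (y + a) 1 ->
  is_derive y 1 (fun x => g (x + a)) (derive1 g (y + a)).
Proof.
move=> dg; rewrite -[X in is_derive _ _ _ X]mulr1.
apply: (@is_derive1_comp _ g (fun x => x + a)).
  by rewrite derive1E; exact/derivableP.
by rewrite -[X in is_derive _ _ _ X]addr0; apply: is_deriveD.
Qed.

Lemma is_derive_idM (g : R -> R) y : derivable g y 1 ->
  is_derive y 1 (fun x => x * g x) (g y + y * derive1 g y).
Proof.
move=> dg; have -> : g y + y * derive1 g y = y *: derive1 g y + g y *: 1.
  by rewrite /GRing.scale/=; ring.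
have dgy : is_derive y 1 g (derive1 g y).
  by rewrite derive1E; exact/derivableP.
exact: (is_deriveM (is_derive_id y 1) dgy).
Qed.

Lemma digammaS y : 0 < y -> digamma (y + 1) = digamma y + y^-1.
Proof.
move=> y0; have y1 : 0 < y + 1 by exact: addr_gt0.
have [dG _] := Gamma_derivableE y0; have [dG1 _] := Gamma_derivableE y1.
have E : derive1 (@Gamma R) (y + 1) = Gamma y + y * derive1 (@Gamma R) y.
  have d1 : is_derive y 1 (fun x => Gamma (x + 1)) (derive1 (@Gamma R) (y + 1)).
    exact: is_derive_shift.
  have d2 : is_derive y 1 (fun x => x * Gamma x) (Gamma y + y * derive1 (@Gamma R) y).
    exact: is_derive_idM.
  have [_ <-] := d1; have [_ <-] := d2.
  (* The functional equation is known for positive arguments, so the two functions are compared only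
     near [y]. *)
  apply: near_eq_derive; near=> x; apply: GammaS; near: x; exact: lt_nbhsr.
rewrite /digamma E GammaS//.
have := Gamma_gt0 y0; move: (Gamma y) => g g0.
by field; rewrite !gt_eqF.
Unshelve. all: by end_near. Qed.

End Digamma.

(** * Binet's formula *)

Section Binet.
Context {R : realType}.
Implicit Types (y z : R) (c : nat).

Definition binet_fun z : R := digamma z - ln z + z^-1.

Lemma binet_fun_le z : 0 < z -> binet_fun z <= z^-1.
Proof. by move=> z0; rewrite /binet_fun gerDr subr_le0 digamma_le. Qed.

(** By the recurrence of [digamma], [binet_fun z] is [digamma (z + 1) - ln z]. *)
Lemma binet_fun_ge0 z : 0 < z -> 0 <= binet_fun z.
Proof.
by move=> z0; have := digammaS_ge z0; rewrite digammaS// /binet_fun; lra.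
Qed.

Lemma binet_fun_step z : 0 < z ->
  binet_fun (z + 1) - binet_fun z = (z + 1)^-1 - (ln (z + 1) - ln z).
Proof. by move=> z0; rewrite /binet_fun digammaS//; ring. Qed.

(* The difference of both sides is 1-periodic and bounded by [z^-1]. *)
Lemma binet_formula c z : (0 < c)%N -> 0 < z ->
  binet_int c (c%:R * z) = binet_fun z.
Proof.
move=> c0 z0; have c0' : 0 < c%:R :> R by rewrite ltr0n.
pose E w := binet_fun w - binet_int c (c%:R * w).
have Estep w : 0 < w -> E (w + 1) = E w.
  move=> w0; have cw : 0 < c%:R * w by exact: mulr_gt0.
  have := binet_int_step c0 cw; have := binet_fun_step w0.
  have -> : c%:R * w + c%:R = c%:R * (w + 1) by ring.
  have w1 : 0 < w + 1 by exact: addr_gt0.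
  rewrite !lnM ?posrE// /E.
  have -> : c%:R / (c%:R * (w + 1)) = (w + 1)^-1 :> R.
    by field; rewrite !gt_eqF.
  lra.
have En n : E (z + n%:R) = E z.
  elim: n => [|n IH]; first by rewrite addr0.
  by rewrite -natr1 addrA Estep// ltr_wpDr.
have Ele w : 0 < w -> `|E w| <= w^-1.
  move=> w0; have cw : 0 < c%:R * w by exact: mulr_gt0.
  have := binet_int_le c0 cw.
  rewrite invfM mulrA divff ?gt_eqF// mul1r => h1.
  have h2 := binet_int_ge0 (c%:R * w) c0.
  have h3 := binet_fun_le w0; have h4 := binet_fun_ge0 w0.
  by rewrite /E ler_norml; apply/andP; split; lra.
suff : E z = 0 by move/eqP; rewrite subr_eq0 => /eqP.
apply/eqP; rewrite -normr_eq0 eq_le normr_ge0 andbT.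
(* Periodicity gives [|E z| = |E (z + n + 1)| <= 1 / (z + n + 1)], which is at most
   [harmonic n = 1 / (n + 1)]. *)
apply: (cvgr_to_ge (@cvg_harmonic R)); apply: nearW => n.
rewrite -(En n.+1); apply: (le_trans (Ele _ _)); first by rewrite ltr_wpDr.
by rewrite lef_pV2 ?posrE ?ltr_wpDr// lerDr ltW.
Qed.

End Binet.

(** * Termwise integration *)

Section Series.
Context {R : realType}.
Local Notation mu := (@lebesgue_measure R).
Local Notation I01 := (`]0, 1[%classic : set R).
Implicit Types (x z u : R).

Lemma ge0_bounded_cvg_sum1 (a : nat -> R) B :
  (forall n, (0 < n)%N -> 0 <= a n) ->
  (forall n, \sum_(1 <= i < n) a i <= B) ->
  cvgn (fun n => \sum_(1 <= i < n) a i).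
Proof.
move=> a0 aB; apply: nondecreasing_is_cvgn; last first.
  by exists B => _ [n _ <-]; exact: aB.
apply/nondecreasing_seqP => -[|n]; first by rewrite !big_geq.
by rewrite [leRHS]big_nat_recr//= lerDl a0.
Qed.

Lemma sum1_le (a b : nat -> R) n : (forall n, (0 < n)%N -> a n <= b n) ->
  \sum_(1 <= i < n) a i <= \sum_(1 <= i < n) b i.
Proof. by move=> ab; apply: ler_sum_nat => i /andP[i0 _]; exact: ab. Qed.

Lemma sum1_geometric_le z n : 0 <= z < 1 ->
  \sum_(1 <= i < n) z ^+ i <= (1 - z)^-1.
Proof.
move=> /andP[z0 z1]; have z1' : 0 < 1 - z by rewrite subr_gt0.
have key m : \sum_(1 <= i < m.+1) z ^+ i = (z - z ^+ m.+1) / (1 - z).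
  elim: m => [|m IH]; first by rewrite big_geq// expr1 subrr mul0r.
  rewrite big_nat_recr//= IH [in RHS]exprS.
  by field; rewrite gt_eqF.
case: n => [|n]; first by rewrite big_geq// invr_ge0 ltW.
rewrite key -[leRHS]mul1r ler_pM2r ?invr_gt0//.
by have := exprn_ge0 n.+1 z0; lra.
Qed.

(** Telescoping with [1 / (r + 1)^2 <= 1 / r - 1 / (r + 1)]. *)
Lemma sum1_invsqr_le n : \sum_(1 <= i < n) (i%:R ^+ 2)^-1 <= 2 :> R.
Proof.
have key m : \sum_(1 <= i < m.+2) (i%:R ^+ 2)^-1 <= 2 - m.+1%:R^-1 :> R.
  elim: m => [|m IH]; first by rewrite big_nat1 expr1n invr1; lra.
  rewrite big_nat_recr//=; apply: (le_trans (lerD IH (lexx _))).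
  have m1 : 0 < m.+1%:R :> R by [].
  rewrite -(natr1 m.+1); move: (m.+1%:R : R) m1 => r r0.
  rewrite -lerBrDl.
  have -> : 2 - (r + 1)^-1 - (2 - r^-1) = (r * (r + 1))^-1.
    by field; rewrite !gt_eqF// ltr_wpDr.
  rewrite lef_pV2 ?posrE ?exprn_gt0 ?mulr_gt0// ?ltr_wpDr//.
  by rewrite expr2 ler_pM2r ?ltr_wpDr// lerDl.
case: n => [|[|n]]; [by rewrite big_geq|by rewrite big_geq|].
by apply: (le_trans (key n)); rewrite gerBl.
Qed.

Lemma Rintegral_sum1 (f : nat -> R -> R) n :
  (forall i, (0 < i)%N -> mu.-integrable I01 (EFin \o f i)) ->
  mu.-integrable I01 (EFin \o (fun u => \sum_(1 <= i < n) f i u)) /\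
  \int[mu]_(u in I01) (\sum_(1 <= i < n) f i u) =
  \sum_(1 <= i < n) \int[mu]_(u in I01) f i u.
Proof.
move=> If; elim: n => [|[|n] IH].
- have -> : (fun u => \sum_(1 <= i < 0) f i u) = cst 0.
    by apply/funext => u; rewrite big_geq.
  by rewrite big_geq//; split; [exact: integrable0|rewrite Rintegral_cst// mul0r].
- have -> : (fun u => \sum_(1 <= i < 1) f i u) = cst 0.
    by apply/funext => u; rewrite big_geq.
  by rewrite big_geq//; split; [exact: integrable0|rewrite Rintegral_cst// mul0r].
- have -> : (fun u => \sum_(1 <= i < n.+2) f i u) =
     (fun u => \sum_(1 <= i < n.+1) f i u + f n.+1 u).
    by apply/funext => u; rewrite big_nat_recr.
  case: IH => I1 I2; split; first exact: (integrableD _ I1 (If n.+1 isT)).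
  by rewrite RintegralD ?I2 ?[RHS]big_nat_recr//; exact: If.
Qed.

(** Monotone convergence for the partial sums. Finiteness of [l] yields the integrability of [s]
    along with the value of its integral. *)
Lemma Rintegral_series (f : nat -> R -> R) (s : R -> R) (l : R) :
  (forall i, (0 < i)%N -> mu.-integrable I01 (EFin \o f i)) ->
  (forall i u, (0 < i)%N -> I01 u -> 0 <= f i u) ->
  (forall u, I01 u -> \sum_(1 <= i < n) f i u @[n --> \oo] --> s u) ->
  \sum_(1 <= i < n) \int[mu]_(u in I01) f i u @[n --> \oo] --> l ->
  mu.-integrable I01 (EFin \o s) /\ \int[mu]_(u in I01) s u = l.
Proof.
move=> If f0 fs fl.
pose g n u := (\sum_(1 <= i < n) f i u)%:E.
have Ig n := (Rintegral_sum1 n If).1.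
have mg n : measurable_fun I01 (g n) by exact: measurable_int (Ig n).
have gs u : I01 u -> g n u @[n --> \oo] --> (s u)%:E.
  by move=> u01; apply: cvg_EFin; [exact: nearW|exact: fs].
have ms : measurable_fun I01 (EFin \o s).
  by apply: (emeasurable_fun_cvg _ _ mg) => u; exact: gs.
have s0 u : I01 u -> 0 <= s u.
  move=> u01; apply: (cvgr_to_ge (fs u u01)); apply: nearW => n.
  by rewrite big_nat sumr_ge0// => i /andP[i0 _]; exact: f0.
have cvg1 : (\int[mu]_(u in I01) g n u @[n --> \oo] -->
             \int[mu]_(u in I01) (s u)%:E)%E.
  have -> : (\int[mu]_(u in I01) (s u)%:E =
             \int[mu]_(u in I01) (limn (g ^~ u)))%E.
    by apply: eq_integral => u /set_mem u01; apply/esym/cvg_lim => //; exact: gs.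
  apply: cvg_monotone_convergence => //.
  - move=> n u u01; rewrite lee_fin big_nat sumr_ge0// => i /andP[i0 _].
    exact: f0.
  - move=> u u01; apply/nondecreasing_seqP => -[|n]; rewrite lee_fin.
      by rewrite !big_geq.
    by rewrite [leRHS]big_nat_recr//= lerDl f0.
have cvg2 : (\int[mu]_(u in I01) g n u @[n --> \oo] --> l%:E)%E.
  have gE n : (\int[mu]_(u in I01) g n u =
               (\sum_(1 <= i < n) \int[mu]_(u in I01) f i u)%R%:E)%E.
    rewrite -(Rintegral_sum1 n If).2 /Rintegral fineK//.
    exact: integrable_fin_num (Ig n).
  rewrite (eq_cvg _ _ gE); apply: cvg_EFin; [exact: nearW|exact: fl].
have sl : (\int[mu]_(u in I01) (s u)%:E = l%:E)%E.
  exact: (cvg_unique _ cvg1 cvg2).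
split; last by rewrite /Rintegral sl.
apply/integrableP; split => //.
rewrite (_ : (\int[mu]_(u in I01) _ = l%:E)%E) ?ltry// -sl.
by apply: eq_integral => u /set_mem u01; rewrite /= ger0_norm ?s0.
Qed.

End Series.

(** * Polylogarithms and Herglotz functions *)

Section Polylog.
Context {R : realType}.
Implicit Types (z t : R) (k N n : nat).

Lemma leq_expn n N : (0 < N)%N -> (n <= n ^ N)%N.
Proof. by case: n N => [|n] [|N]// _; rewrite expnS leq_pmulr// expn_gt0. Qed.

(** Comparison with the geometric series, from [i <= i ^ N] and [1 <= i ^ k]. *)
Lemma Li_cvg N k z : (0 < N)%N -> 0 <= z < 1 ->
  \sum_(1 <= i < n) (z ^+ (i ^ N) / i%:R `^ k%:R) @[n --> \oo] --> Li N k%:R z.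
Proof.
move=> N0 z01; have /andP[z0 z1] := z01.
apply: (@ge0_bounded_cvg_sum1 _ _ (1 - z)^-1) => n.
  by move=> _; rewrite divr_ge0 ?exprn_ge0 ?powR_ge0.
apply: le_trans (sum1_geometric_le n z01).
apply: sum1_le => i i0; rewrite powR_mulrn//.
apply: (@le_trans _ _ (z ^+ (i ^ N))).
  by rewrite ler_piMr ?exprn_ge0// invf_le1 ?exprn_gt0 ?ltr0n// exprn_ege1// ler1n.
by rewrite ler_wiXn2l// ?(ltW z1)// leq_expn.
Qed.

(* The even-indexed terms of the series are the series at [z ^+ (2 ^ N)]. *)
Lemma Li_partial_opp N k z n : (0 < N)%N ->
  \sum_(1 <= i < n.+1) ((- z) ^+ (i ^ N) / i%:R `^ k%:R) =
  - (\sum_(1 <= i < n.+1) (z ^+ (i ^ N) / i%:R `^ k%:R))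
  + 2 / 2 ^+ k *
    \sum_(1 <= i < n./2.+1) ((z ^+ (2 ^ N)) ^+ (i ^ N) / i%:R `^ k%:R).
Proof.
move=> N0; elim: n => [|n IH]; first by rewrite !big_geq// oppr0 add0r mulr0.
rewrite [LHS]big_nat_recr//= IH [in RHS]big_nat_recr//=.
rewrite [in LHS]exprNn -signr_odd oddX eqn0Ngt N0/= uphalf_half.
(* The new index is [n + 1]. If it is odd, the term changes sign and the second sum does not grow.
   If it is [2 m], the term keeps its sign, so twice the term is due; [(2 m) ^ N = 2 ^ N * m ^ N]
   and [(2 m) ^ k = 2 ^ k * m ^ k] make this the [m]-th term of the second sum. *)
have [on|en] := boolP (odd n); last by rewrite add0n expr1; ring.
rewrite add1n /= expr0 mul1r [X in _ = _ + _ * X]big_nat_recr//=.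
set m := (n./2).+1.
have -> : n.+1 = (2 * m)%N.
  by rewrite -[LHS]odd_double_half/= on add0n uphalf_half on mul2n.
rewrite -exprM expnMn !powR_mulrn// natrM exprMn.
have m0 : m%:R != 0 :> R by rewrite pnatr_eq0.
move: (m%:R : R) m0 => r r0; field.
by rewrite !expf_neq0.
Qed.

Lemma Li_opp N k z : (0 < N)%N -> 0 <= z < 1 ->
  Li N k%:R (- z) = - Li N k%:R z + 2 / 2 ^+ k * Li N k%:R (z ^+ (2 ^ N)).
Proof.
move=> N0 z01; have /andP[z0 z1] := z01.
have z01' : 0 <= z ^+ (2 ^ N) < 1.
  by rewrite exprn_ge0//= exprn_ilt1// expn_eq0.
apply/cvg_lim => //; rewrite -cvg_shiftS/=.
rewrite (eq_cvg _ _ (fun n => @Li_partial_opp N k z n N0)).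
apply: cvgD.
  by apply: cvgN; have := @Li_cvg N k _ N0 z01; rewrite -cvg_shiftS.
apply: cvgM; first exact: cvg_cst.
have := @Li_cvg N k _ N0 z01'; apply: cvg_comp.
(* The second sum stops at [n./2], which tends to infinity with [n]. *)
apply/cvgnyPge => A; near=> n.
rewrite ltnW// ltnS geq_half_double.
by near: n; exact: nbhs_infty_ge.
Unshelve. all: by end_near. Qed.

End Polylog.

(** * Series of Binet values and their integral representation *)

Section Herglotz.
Context {R : realType}.
Local Notation mu := (@lebesgue_measure R).
Local Notation I01 := (`]0, 1[%classic : set R).
Implicit Types (x u : R) (k N n c : nat).

Lemma inv_pow_le k N n : (0 < k)%N -> (0 < N)%N -> (0 < n)%N ->
  (n%:R ^+ (k + N))^-1 <= (n%:R ^+ 2)^-1 :> R.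
Proof.
move=> k0 N0 n0; rewrite lef_pV2 ?posrE ?exprn_gt0 ?ltr0n//.
by rewrite ler_weXn2l ?ler1n//; case: k N k0 N0 => [|k] [|N]// _ _; rewrite addSn addnS.
Qed.

Lemma zeta_cvg k N : (0 < k)%N -> (0 < N)%N ->
  \sum_(1 <= i < n) (i%:R `^ (k + N)%:R)^-1 @[n --> \oo] --> zeta ((k + N)%:R : R).
Proof.
move=> k0 N0; apply: (@ge0_bounded_cvg_sum1 _ _ 2) => n.
  by move=> _; rewrite invr_ge0 powR_ge0.
apply: le_trans (sum1_invsqr_le n).
by apply: sum1_le => i i0; rewrite powR_mulrn// inv_pow_le.
Qed.

(** The Herglotz series with [1 / (n ^ N * x)] added to each difference of [digamma] and [ln]: its
    terms are nonnegative, and they are what the kernel integrals produce. *)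
Definition binet_series k N x : R :=
  \big[+%R/0]_(1 <= n <oo) (binet_fun (n%:R ^+ N * x) / n%:R ^+ k).

(** The bound [binet_fun z <= 1 / z] makes the terms at most [1 / (x * n ^ (k + N))], with
    [k + N >= 2]. *)
Lemma binet_series_cvg k N x : (0 < k)%N -> (0 < N)%N -> 0 < x ->
  \sum_(1 <= i < n) (binet_fun (i%:R ^+ N * x) / i%:R ^+ k) @[n --> \oo]
    --> binet_series k N x.
Proof.
move=> k0 N0 x0.
have pos i : (0 < i)%N -> 0 < i%:R ^+ N * x.
  by move=> i0; rewrite mulr_gt0 ?exprn_gt0 ?ltr0n.
apply: (@ge0_bounded_cvg_sum1 _ _ (x^-1 * 2)) => n.
  by move=> n0; rewrite divr_ge0 ?exprn_ge0// binet_fun_ge0// pos.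
apply: (@le_trans _ _ (x^-1 * \sum_(1 <= i < n) (i%:R ^+ 2)^-1)); last first.
  by rewrite ler_pM2l ?invr_gt0// sum1_invsqr_le.
rewrite big_distrr/=; apply: sum1_le => i i0.
apply: (@le_trans _ _ (x^-1 * (i%:R ^+ (k + N))^-1)); last first.
  by rewrite ler_pM2l ?invr_gt0// inv_pow_le.
rewrite exprD invfM (mulrC (_ ^- k)) mulrA ler_pM2r ?invr_gt0 ?exprn_gt0 ?ltr0n//.
by rewrite (le_trans (binet_fun_le (pos _ i0)))// invfM mulrC.
Qed.

Lemma binet_seriesE k N x : (0 < k)%N -> (0 < N)%N -> 0 < x ->
  herglotz k%:R N%:R x = binet_series k N x - zeta (k + N)%:R / x.
Proof.
move=> k0 N0 x0; apply/cvg_lim => //.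
have E n : \sum_(1 <= i < n)
    ((digamma (i%:R `^ N%:R * x) - ln (i%:R `^ N%:R * x)) / i%:R `^ k%:R) =
    \sum_(1 <= i < n) (binet_fun (i%:R ^+ N * x) / i%:R ^+ k)
    - (\sum_(1 <= i < n) (i%:R `^ (k + N)%:R)^-1) / x.
  rewrite big_distrl/= -sumrB; apply: eq_big_nat => i /andP[i0 _].
  rewrite !powR_mulrn// /binet_fun exprD.
  have : i%:R != 0 :> R by rewrite pnatr_eq0 -lt0n.
  move: (digamma _) (ln _) => a b; move: (i%:R : R) => r r0; field.
  by rewrite !expf_neq0// (gt_eqF x0).
rewrite (eq_cvg _ _ E); apply: cvgB; first exact: binet_series_cvg.
by apply: cvgM; [exact: zeta_cvg|exact: cvg_cst].
Qed.

Lemma powR_lt1 x u : 0 < x -> I01 u -> 0 <= u `^ x < 1.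
Proof.
move=> x0 /mem_itv01[u0 u1 l0]; rewrite powR_ge0/= /powR (gt_eqF u0).
by rewrite expR_lt1 pmulr_rlt0.
Qed.

Lemma Rintegral_binet_Li c k N x : (0 < c)%N -> (0 < k)%N -> (0 < N)%N -> 0 < x ->
  mu.-integrable I01
    (EFin \o (fun u => binet_kernel c u * Li N k%:R (u `^ x))) /\
  \int[mu]_(u in I01) (binet_kernel c u * Li N k%:R (u `^ x)) =
  binet_series k N (x / c%:R).
Proof.
move=> c0 k0 N0 x0; have c0' : 0 < c%:R :> R by rewrite ltr0n.
pose f n u := binet_kernel c u * ((u `^ x) ^+ (n ^ N) / n%:R `^ k%:R).
have fE n : f n = fun u =>
    (n%:R ^+ k)^-1 * (binet_kernel c u * u `^ (n%:R ^+ N * x)).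
  apply/funext => u; rewrite /f powR_mulrn// -powR_mulrn ?powR_ge0//.
  by rewrite -powRrM natrX [x * _]mulrC; ring.
have pos n : (0 < n)%N -> 0 < n%:R ^+ N * x.
  by move=> n0; rewrite mulr_gt0 ?exprn_gt0 ?ltr0n.
have If n : (0 < n)%N -> mu.-integrable I01 (EFin \o f n).
  move=> n0; rewrite fE.
  exact: (integrableZl _ _ (integrable_binet_kernelM c0 (pos n n0))).
apply: (@Rintegral_series _ f) => //.
- move=> n u _ u01; have /andP[z0 _] := powR_lt1 x0 u01.
  by rewrite mulr_ge0 ?binet_kernel_ge0// divr_ge0 ?exprn_ge0 ?powR_ge0.
- move=> u u01.
  under eq_cvg do rewrite -big_distrr/=.
  by apply: cvgM; [exact: cvg_cst|exact/Li_cvg/powR_lt1].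
- have E n : \sum_(1 <= i < n) \int[mu]_(u in I01) f i u =
     \sum_(1 <= i < n) (binet_fun (i%:R ^+ N * (x / c%:R)) / i%:R ^+ k).
    apply: eq_big_nat => i /andP[i0 _]; rewrite fE RintegralZl//; last first.
      exact: integrable_binet_kernelM (pos i i0).
    (* Binet's formula is used at [z = i ^ N * (x / c)], so that the exponent [c * z] is
       [i ^ N * x]. *)
    rewrite mulrC -(binet_formula c0); last by rewrite mulrA divr_gt0// pos.
    rewrite /binet_int; congr (_ / _); apply: eq_Rintegral => u _.
    by congr (_ * _ `^ _); field; rewrite gt_eqF.
  by rewrite (eq_cvg _ _ E); apply: binet_series_cvg => //; exact: divr_gt0.
Qed.

Lemma J_integrandE k N x u : (0 < N)%N -> 0 < x -> I01 u ->
  let p : R := 2 ^ (k%:Z - 1) in let q : R := 2 ^ (1 - k%:Z) in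
  let h c y := binet_kernel c u * Li N k%:R (u `^ y) in
  J_integrand k N x u =
  (h 1%N (2 ^+ N * x) - p * h 1%N x) + (h (2 ^ N)%N x - q * h (2 ^ N)%N (2 ^+ N * x)).
Proof.
move=> N0 x0 u01 p q h; have [u0 u1 l0] := mem_itv01 u01.
have pq : p * q = 1.
  rewrite /p /q -expfzDr ?pnatr_eq0// (_ : k%:Z - 1 + (1 - k%:Z) = 0) ?expr0z//.
  by rewrite addrA subrK subrr.
have q2 : q = 2 / 2 ^+ k by rewrite /q expfzDr ?pnatr_eq0// -exprnN.
rewrite /J_integrand Li_opp// ?powR_lt1// -q2.
have -> : (u `^ x) ^+ (2 ^ N) = u `^ (2 ^+ N * x).
  by rewrite -powR_mulrn ?powR_ge0// -powRrM natrX mulrC.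
(* The coefficient [p - 1] of [1 / (u * ln u)] is exactly what [p] copies of one kernel minus one
   copy of the other leave over. *)
have -> : 2 ^ (k%:Z - 1) / (u - 1)
   - 2 ^+ N * u ^+ (2 ^ N - 1) / (u ^+ (2 ^ N) - 1)
   - (2 ^ (k%:Z - 1) - 1) / (u * ln u) =
   p * binet_kernel 1 u - binet_kernel (2 ^ N) u.
  rewrite /binet_kernel -/p natrX expr0 expr1; ring.
rewrite /h; move: (Li N k%:R (u `^ x)) => A; move: (Li _ _ _) => B.
(* The expansion gives this product the coefficient [p * q], which is 1. *)
have -> : binet_kernel 1 u * B = p * q * (binet_kernel 1 u * B) by rewrite pq mul1r.
by ring.
Qed.

End Herglotz.

(** * The integral [J] as a combination of four Binet series *)

Theorem theorem2p8 (R : realType) (k N : nat) (x : R)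
    (k_gt0 : (0 < k)%N) (N_gt0 : (0 < N)%N) (x_gt0 : 0 < x) :
  (@lebesgue_measure R).-integrable `]0, 1[
    (fun u => (J_integrand k N x u)%:E) /\
  J k N x =
    herglotz k%:R N%:R (2 ^+ N * x)
    - (2 ^ (k%:Z - 1) + 2 ^ (1 - k%:Z)) * herglotz k%:R N%:R x
    + herglotz k%:R N%:R (x / 2 ^+ N)
    + (2 ^+ N + 2 ^- N - 2 ^ (k%:Z - 1) - 2 ^ (1 - k%:Z))
      * (zeta (k + N)%:R / x).
Proof.
set mu := @lebesgue_measure R.
have M0 : 0 < 2 ^+ N :> R by rewrite exprn_gt0.
have Mx0 : 0 < 2 ^+ N * x by exact: mulr_gt0.
have xM0 : 0 < x / 2 ^+ N by exact: divr_gt0.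
have MN0 : (0 < 2 ^ N)%N by rewrite expn_gt0.
(* At [2 ^ N * x], [x] and [x / 2 ^ N] this subtracts [2 ^ - N], [1] and [2 ^ N] times
   [zeta (k + N) / x]. Weighted by [1], [- (p + q)] and [1], these cancel the explicit zeta term,
   leaving only Binet series. *)
rewrite !binet_seriesE//.
set p := 2 ^ (k%:Z - 1); set q := 2 ^ (1 - k%:Z).
pose h c y u : R := binet_kernel c u * Li N k%:R (u `^ y).
(* The quotients [y / c] are in turn [2 ^ N * x], [x], [x / 2 ^ N] and again [x]; the second and
   fourth integrals together account for the coefficient [- (p + q)]. *)
have [I1 E1] := Rintegral_binet_Li (ltn0Sn 0) k_gt0 N_gt0 Mx0.
have [I2 E2] := Rintegral_binet_Li (ltn0Sn 0) k_gt0 N_gt0 x_gt0.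
have [I3 E3] := Rintegral_binet_Li MN0 k_gt0 N_gt0 x_gt0.
have [I4 E4] := Rintegral_binet_Li MN0 k_gt0 N_gt0 Mx0.
rewrite divr1 in E1; rewrite divr1 in E2; rewrite natrX in E3.
rewrite natrX mulrAC divff ?gt_eqF// mul1r in E4.
have I2' : mu.-integrable `]0, 1[ (EFin \o (fun u => p * h 1%N x u)).
  exact: (integrableZl _ p I2).
have I4' : mu.-integrable `]0, 1[
    (EFin \o (fun u => q * h (2 ^ N)%N (2 ^+ N * x) u)).
  exact: (integrableZl _ q I4).
have J1 : mu.-integrable `]0, 1[
    (EFin \o (fun u => h 1%N (2 ^+ N * x) u - p * h 1%N x u)).
  exact: (integrableB _ I1 I2').
have J2 : mu.-integrable `]0, 1[
    (EFin \o (fun u => h (2 ^ N)%N x u - q * h (2 ^ N)%N (2 ^+ N * x) u)).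
  exact: (integrableB _ I3 I4').
split.
  apply: eq_integrable (integrableD _ J1 J2) => // u /set_mem u01.
  by rewrite J_integrandE.
rewrite /J; under eq_Rintegral => u /set_mem u01 do rewrite J_integrandE//.
rewrite RintegralD//.
rewrite (RintegralB _ I1 I2')// (RintegralB _ I3 I4')//.
rewrite (RintegralZl p _ I2)// (RintegralZl q _ I4)// E1 E2 E3 E4.
by field; rewrite !gt_eqF.
Qed.
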